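(* Let $R$ be a semiperfect ring, let $S$ be a basic ring that is Morita equivalent to $R$ over $\mathrm{Cent}(R)$, and let $\sigma\in\mathrm{Aut}(\mathrm{Cent}(R))$. Then $R$ is Morita equivalent to $R^{\mathrm{op}}$ via an equivalence of type $\sigma$ if and only if $S$ has an anti-automorphism of type $\sigma$.
   Context: Rings are unital. $R$ is semiperfect if $R/\mathrm{Jac}(R)$ is semisimple artinian and idempotents lift modulo the Jacobson radical $\mathrm{Jac}(R)$. A semiperfect ring has finitely many indecomposable finitely generated projective right modules $P_1,\dots,P_t$ up to isomorphism, and $R_R\cong\bigoplus_i P_i^{m_i}$ with uniquely determined $m_i\ge 1$; it is called basic if $m_1=\dots=m_t=1$. Every semiperfect $R$ is Morita equivalent over $\mathrm{Cent}(R)$ to a basic ring, unique up to isomorphism of $\mathrm{Cent}(R)$-algebras, namely $\mathrm{End}_R(P_1\oplus\dots\oplus P_t)$. A right $R$-progenerator is a finitely generated projective right $R$-module that is a generator. An $(S,R)$-progenerator is an $(S,R)$-bimodule $P$ such that $P_R$ is a progenerator and every endomorphism of $P_R$ has the form $p\mapsto sp$ for a unique $s\in S$. Let $C$ be a commutative ring and $R,S$ central $C$-algebras (i.e. $c\mapsto c\cdot 1$ is an isomorphism from $C$ onto the center). The type of an $(S,R)$-progenerator $P$ (and of the corresponding equivalence $(-)\otimes_S P:\mathrm{Mod}\text{-}S\to\mathrm{Mod}\text{-}R$) is the automorphism $\sigma$ of $C$ with $\sigma(c)p=pc$ for all $p\in P$, $c\in C$. $R$ and $S$ are Morita equivalent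 over $C$ if there is an $(S,R)$-progenerator of type $\mathrm{id}_C$. ''$R$ is Morita equivalent to $R^{\mathrm{op}}$ via an equivalence of type $\sigma$'' means that there is an $(R^{\mathrm{op}},R)$-progenerator of type $\sigma$. The type of an anti-automorphism of a central $C$-algebra is its restriction to the center, viewed as an automorphism of $C$; here $C=\mathrm{Cent}(R)$. *)

(* Defs.v *)
From HB Require Import structures.
From mathcomp Require Import all_boot all_order all_algebra.
From mathcomp Require Import boolp classical_sets.

Set Implicit Arguments.
Unset Strict Implicit.
Unset Printing Implicit Defensive.

Import GRing.Theory.
Local Open Scope ring_scope.
Local Open Scope classical_set_scope.

(* Rings are unital and possibly zero ([pzRingType]).  A right R-module is a  *)
(* left module over the opposite ring R^c; [(R^c)^o] is R as a right module   *)
(* over itself, so that right ideals are submodules of [(R^c)^o].             *)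

Notation rmodType R := (lmodType R^c).

Definition ract (R : pzRingType) (M : rmodType R) (x : M) (a : R) : M :=
  (a : R^c) *: x.

Definition right_regular (R : pzRingType) : rmodType R := (R^c)^o.

Section Modules.
Variable R : pzRingType.
Implicit Types M N P : rmodType R.

Definition submodule M (U : set M) : Prop :=
  [/\ U 0, forall x y, U x -> U y -> U (x + y)
     & forall x (a : R), U x -> U (ract x a)].

Definition complementary M (U V : set M) : Prop :=
  (forall x, U x -> V x -> x = 0) /\
  (forall x, exists u v, [/\ U u, V v & x = u + v]).

Definition isomorphic M N : Prop := exists f : {linear M -> N}, bijective f.

Definition finitely_generated M : Prop :=
  exists (n : nat) (v : 'I_n -> M),
    forall x, exists a : 'I_n -> R, x = \sum_(i < n) ract (v i) (a i).

Definition projective P : Prop :=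
  forall (M N : rmodType R) (g : {linear M -> N}) (f : {linear P -> N}),
    (forall y, exists x, g x = y) ->
    exists h : {linear P -> M}, forall p, g (h p) = f p.

(* The functor Hom(P, -) is faithful. *)
Definition generator P : Prop :=
  forall (M N : rmodType R) (f g : {linear M -> N}),
    (forall (h : {linear P -> M}) p, f (h p) = g (h p)) -> f =1 g.

Definition progenerator P : Prop :=
  [/\ finitely_generated P, projective P & generator P].

Definition indecomposable M : Prop :=
  (exists x : M, x <> 0) /\
  (forall U V : set M, submodule U -> submodule V -> complementary U V ->
     (forall x, U x -> x = 0) \/ (forall x, V x -> x = 0)).

(* M is isomorphic to the direct sum of the family N. *)
Definition is_direct_sum M (t : nat) (N : 'I_t -> rmodType R) : Prop :=
  exists f : forall i, {linear N i -> M},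
    (forall x, exists p : forall i, N i, x = \sum_(i < t) f i (p i)) /\
    (forall p : forall i, N i,
       \sum_(i < t) f i (p i) = 0 -> forall i, p i = 0).

(* P_1, ..., P_t is a list of representatives of the isomorphism classes of   *)
(* indecomposable finitely generated projective right R-modules.              *)
Definition indec_projectives (t : nat) (P : 'I_t -> rmodType R) : Prop :=
  [/\ forall i, [/\ finitely_generated (P i), projective (P i)
                  & indecomposable (P i)],
      forall i j, isomorphic (P i) (P j) -> i = j
    & forall M, finitely_generated M -> projective M -> indecomposable M ->
        exists i, isomorphic M (P i)].

(* The right regular module is isomorphic to the sum of the P_i ^ (m_i). *)
Definition multiplicities (t : nat) (P : 'I_t -> rmodType R)
    (m : 'I_t -> nat) : Prop :=
  @is_direct_sum (right_regular R) t (fun i => {ffun 'I_(m i) -> P i}).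

End Modules.

Section SemiperfectRings.
Variable R : pzRingType.

Definition right_ideal (I : set (right_regular R)) : Prop := submodule I.

Definition maximal_right_ideal (I : set (right_regular R)) : Prop :=
  [/\ right_ideal I, I <> setT
    & forall J, right_ideal J -> I `<=` J -> J = I \/ J = setT].

Definition jacobson_radical : set R :=
  [set x : R | forall I, maximal_right_ideal I -> I x].

Definition semisimple : Prop :=
  forall I, right_ideal I -> exists2 J, right_ideal J & complementary I J.

Definition right_artinian : Prop :=
  forall I : nat -> set (right_regular R), (forall n, right_ideal (I n)) ->
    (forall n, I n.+1 `<=` I n) ->
    exists n, forall k, (n <= k)%N -> I k = I n.

End SemiperfectRings.

Definition idempotents_lift (R : pzRingType) (J : set R) : Prop :=
  forall x : R, J (x * x - x) -> exists2 e : R, e * e = e & J (e - x).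

(* The quotient ring R / Jac(R) is presented as a surjective ring morphism    *)
(* with kernel Jac(R), which determines it up to isomorphism: the quotient    *)
(* rings of the library are restricted to commutative rings.                  *)
Definition semiperfect (R : pzRingType) : Prop :=
  (exists (Q : pzRingType) (pi : {rmorphism R -> Q}),
     [/\ forall y, exists x, pi x = y,
         forall x, pi x = 0 <-> jacobson_radical x
       & semisimple Q /\ right_artinian Q]) /\
  idempotents_lift (@jacobson_radical R).

Definition basic (R : pzRingType) : Prop :=
  semiperfect R /\
  exists (t : nat) (P : 'I_t -> rmodType R) (m : 'I_t -> nat),
    [/\ indec_projectives P, multiplicities P m & forall i, m i = 1%N].

Section Center.
Variable R : pzRingType.

Definition central (x : R) : Prop := forall y : R, x * y = y * x.

Definition center_pred : {pred R} := fun x => `[< central x >].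

Lemma center_predP (x : R) : reflect (central x) (x \in center_pred).
Proof. exact: asboolP. Qed.

Fact center_pred_subring : subring_closed center_pred.
Proof.
split.
- by apply/center_predP => y; rewrite mul1r mulr1.
- move=> x y /center_predP cx /center_predP cy.
  by apply/center_predP => z; rewrite mulrBl mulrBr cx cy.
- move=> x y /center_predP cx /center_predP cy.
  by apply/center_predP => z; rewrite -mulrA cy mulrA cx mulrA.
Qed.

Record Cent : Type := MkCent { Cent_val : R; _ : Cent_val \in center_pred }.

HB.instance Definition _ := [isSub for Cent_val].
HB.instance Definition _ := [Choice of Cent by <:].
HB.instance Definition _ :=
  GRing.SubChoice_isSubPzRing.Build R center_pred Cent center_pred_subring.

Fact Cent_mulC : commutative (@GRing.mul Cent).
Proof.
by move=> x y; apply: val_inj; rewrite !rmorphM; apply: (center_predP _ (valP x)).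
Qed.

HB.instance Definition _ :=
  GRing.PzRing_hasCommutativeMul.Build Cent Cent_mulC.

End Center.

(* A central C-algebra A, with structure map c |-> c . 1 from C to A.  The    *)
(* library's [algType C] is not used because it excludes the zero ring.       *)
Record centralAlgType (C : comPzRingType) := CentralAlg {
  calg_sort :> pzRingType;
  calg_in : {rmorphism C -> calg_sort};
  calg_in_inj : injective calg_in;
  calg_centerP : forall x, central x <-> exists c, calg_in c = x
}.

Section SelfAlgebra.
Variable R : pzRingType.

Let Cent_in : {rmorphism Cent R -> R} := val.

Fact Cent_inP (x : R) : central x <-> exists c, Cent_in c = x.
Proof.
split=> [cx | [c <-]]; last exact: (center_predP _ (valP c)).
by have hx := introT (center_predP x) cx; exists (MkCent hx).
Qed.

Definition Cent_calg : centralAlgType (Cent R) :=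
  @CentralAlg (Cent R) R Cent_in val_inj Cent_inP.

End SelfAlgebra.

Section OppositeAlgebra.
Variables (C : comPzRingType) (A : centralAlgType C).

Definition calg_op_in (c : C) : A^c := calg_in A c.

Fact calg_op_in_zmod : zmod_morphism calg_op_in.
Proof. by move=> x y; rewrite /calg_op_in rmorphB. Qed.

Fact calg_op_in_monoid : monoid_morphism calg_op_in.
Proof.
split=> [|x y]; first exact: (rmorph1 (calg_in A)).
by rewrite /calg_op_in mulrC rmorphM.
Qed.

HB.instance Definition _ :=
  GRing.isZmodMorphism.Build C A^c calg_op_in calg_op_in_zmod.
HB.instance Definition _ :=
  GRing.isMonoidMorphism.Build C A^c calg_op_in calg_op_in_monoid.

Fact calg_op_inP (x : A^c) : central x <-> exists c, calg_op_in c = x.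
Proof.
rewrite -(calg_centerP (x : A)).
by split=> cx y; apply/esym; apply: cx.
Qed.

Definition calg_op : centralAlgType C :=
  @CentralAlg C A^c calg_op_in (@calg_in_inj C A) calg_op_inP.

End OppositeAlgebra.

Record bimodType (S R : pzRingType) := Bimod {
  bimod_sort :> rmodType R;
  lact : S -> bimod_sort -> bimod_sort;
  lactA : forall s t p, lact s (lact t p) = lact (s * t) p;
  lact1 : forall p, lact 1 p = p;
  lactDl : forall s t p, lact (s + t) p = lact s p + lact t p;
  lactDr : forall s p q, lact s (p + q) = lact s p + lact s q;
  lact_ract : forall s p (a : R), lact s (ract p a) = ract (lact s p) a
}.

Definition biprogenerator (S R : pzRingType) (P : bimodType S R) : Prop :=
  progenerator P /\
  (forall f : {linear P -> P}, exists! s : S, forall p, f p = lact s p).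

Section Morita.
Variable C : comPzRingType.

Definition has_type (S R : centralAlgType C) (P : bimodType S R)
    (sigma : C -> C) : Prop :=
  forall (p : P) (c : C), lact (calg_in S (sigma c)) p = ract p (calg_in R c).

Definition progenerator_of_type (S R : centralAlgType C) (sigma : C -> C) :
    Prop :=
  exists2 P : bimodType S R, biprogenerator P & has_type P sigma.

Definition morita_equivalent_over (R S : centralAlgType C) : Prop :=
  progenerator_of_type S R id.

Definition morita_equivalent_to_op (R : centralAlgType C) (sigma : C -> C) :
    Prop :=
  progenerator_of_type (calg_op R) R sigma.

(* An anti-automorphism of S is an isomorphism from S to the opposite ring. *)
Definition has_anti_automorphism (S : centralAlgType C) (sigma : C -> C) :
    Prop :=
  exists tau : {rmorphism S -> S^c},
    bijective tau /\ forall c, tau (calg_in S c) = calg_in S (sigma c).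

End Morita.

(* Main.v *)
(* Progenerators are handled through coordinates: P_R is a progenerator iff   *)
(* it has a finite dual basis and 1 = sum_j psi_j(y_j) for finitely many      *)
(* psi_j in Hom(P, R).  In these coordinates Hom_R(P, Q) is seen to be a      *)
(* (T,S)-progenerator whenever P is an (S,R)- and Q a (T,R)-progenerator, and *)
(* P itself to be an (R^op,S^op)-progenerator; types compose accordingly.     *)
(* Hence R and R^op are equivalent with type sigma iff S and S^op are.        *)
(*   For a basic S, write S_S as the sum of the e_i S with orthogonal         *)
(* idempotents e_i, and let Q be an (S^op,S)-progenerator.  Since End(Q_S) is *)
(* S^op, the t summands e_i Q of Q are indecomposable and pairwise            *)
(* nonisomorphic, like the S e_i.  Hence they are, up to a permutation, the t *)
(* indecomposable projectives, so Q_S and S_S are isomorphic, and comparing   *)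
(* endomorphism rings gives the anti-automorphism.                            *)

From HB Require Import structures.
From mathcomp Require Import all_boot all_order all_algebra.
From mathcomp Require Import boolp classical_sets.
Require Import Defs.

Set Implicit Arguments.
Unset Strict Implicit.
Unset Printing Implicit Defensive.

Import GRing.Theory.
Local Open Scope ring_scope.

(** Two reductions carry the proof. The first replaces R by S. If [P] is an (S,R)-progenerator of
    type id, then Hom(P, R) leads back from R to S and [op_bimod P] links the opposite rings.
    Composing these with an (R^op,R)-progenerator keeps its type, and the argument is symmetric in R
    and S ([morita_equivalent_to_op_invariant]). The second treats S alone. An anti-automorphism
    makes the regular module an (S^op,S)-progenerator, with S^op acting through the inverse.
    Conversely, let [Q] be an (S^op,S)-progenerator with Q_S isomorphic to S_S: both have
    endomorphism rings given by left actions, S for S_S and S^op for Q_S, and conjugation by the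
    isomorphism identifies them ([regular_anti_automorphism]). That Q_S is isomorphic to S_S is
    where basicness enters ([basic_progenerator_regular]). With P_i = e_i S, Hom(e_i Q, e_j Q) is
    e_i S e_j, that is, Hom(P_j, P_i). This faithful contravariant correspondence [dual_hom] makes
    the e_i Q indecomposable and pairwise nonisomorphic. Each is some P_(s i), and the injection [s]
    of a finite set into itself is a permutation. *)

(** * Right modules and their linear maps *)

Section RightAction.
Variable R : pzRingType.
Implicit Types M N : rmodType R.

Lemma ractA M (x : M) (a b : R) : ract (ract x a) b = ract x (a * b).
Proof. by rewrite /ract scalerA. Qed.

Lemma ract1 M (x : M) : ract x 1 = x.
Proof. exact: scale1r. Qed.

Lemma ractDl M (x y : M) (a : R) : ract (x + y) a = ract x a + ract y a.
Proof. exact: scalerDr. Qed.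

Lemma ractDr M (x : M) (a b : R) : ract x (a + b) = ract x a + ract x b.
Proof. exact: scalerDl. Qed.

Lemma ract_suml M (I : finType) (F : I -> M) (a : R) :
  ract (\sum_i F i) a = \sum_i ract (F i) a.
Proof. exact: scaler_sumr. Qed.

Lemma ract_sumr M (I : finType) (x : M) (F : I -> R) :
  ract x (\sum_i F i) = \sum_i ract x (F i).
Proof. exact: (@scaler_suml R^c M). Qed.

Lemma linear_ract M N (f : {linear M -> N}) (x : M) (a : R) :
  f (ract x a) = ract (f x) a.
Proof. exact: linearZ. Qed.

Lemma linear_regular M (f : {linear M -> right_regular R}) (x : M) (a : R) :
  f (ract x a) = (f x : R) * a.
Proof. exact: linear_ract. Qed.

Lemma linear_regular1 M (f : {linear right_regular R -> M}) (x : R) :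
  f x = ract (f (1 : R)) x.
Proof. by rewrite -linear_ract /ract -[in LHS](mul1r x). Qed.

Section Linear.
Variables (M N : rmodType R) (f : M -> N).
Hypotheses (fD : forall x y, f (x + y) = f x + f y)
           (fZ : forall x (a : R), f (ract x a) = ract (f x) a).

Fact mklinear_subproof : linear f.
Proof. by move=> a x y; rewrite fD; congr (_ + _); apply: fZ. Qed.

Definition mklinear : {linear M -> N} :=
  HB.pack f (GRing.isLinear.Build _ _ _ _ f mklinear_subproof).

Lemma mklinearE x : mklinear x = f x. Proof. by []. Qed.
End Linear.

(** The linearity proofs agree by proof irrelevance. This is what allows equations in Hom(P, Q) to
    be checked pointwise. *)
Lemma linear_ext M N (f g : {linear M -> N}) : f =1 g -> f = g.
Proof.
case: f g => f [[f1] [f2]] [g [[g1] [g2]]] /= /funext efg; case: _ / efg in g1 g2 *.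
by congr (GRing.Linear.Pack (GRing.Linear.Class _ _)); congr (_ _);
  apply: Prop_irrelevance.
Qed.

Definition regular_ract M (x : M) : {linear right_regular R -> M} :=
  mklinear (M := right_regular R) (f := fun a : R => ract x a)
    (@ractDr M x) (fun a b => esym (ractA x a b)).

Lemma linear_inverse M N (f : {linear M -> N}) : bijective f ->
  exists g : {linear N -> M}, cancel f g /\ cancel g f.
Proof.
move=> [g fK gK].
have gD x y : g (x + y) = g x + g y.
  by apply: (can_inj fK); rewrite linearD !gK.
have gZ x a : g (ract x a) = ract (g x) a.
  by apply: (can_inj fK); rewrite linear_ract !gK.
by exists (mklinear gD gZ).
Qed.

End RightAction.

(** * Dual bases and trace one *)

Section Progenerators.
Variable R : pzRingType.
Implicit Types M N P : rmodType R.

Definition dual_basis P (I : finType) (x : I -> P)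
    (phi : I -> {linear P -> right_regular R}) : Prop :=
  forall p, \sum_i ract (x i) (phi i p) = p.

Definition trace_one P (J : finType) (psi : J -> {linear P -> right_regular R})
    (y : J -> P) : Prop :=
  \sum_j psi j (y j) = 1 :> R.

Lemma dual_basis_retract P N (I : finType) (x : I -> P)
    (phi : I -> {linear P -> right_regular R})
    (f : {linear P -> N}) (g : {linear N -> P}) :
  dual_basis x phi -> cancel g f ->
  dual_basis (f \o x) (fun i => phi i \o g : {linear N -> right_regular R}).
Proof.
move=> xphi gK p; rewrite -[RHS]gK -[g p in RHS]xphi raddf_sum.
by apply: eq_bigr => i _ /=; rewrite linear_ract.
Qed.

Lemma dual_basis_finitely_generated P (I : finType) (x : I -> P)
    (phi : I -> {linear P -> right_regular R}) :
  dual_basis x phi -> finitely_generated P.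
Proof.
move=> xphi; exists #|I|, (fun k => x (enum_val k)) => p.
exists (fun k => phi (enum_val k) p); rewrite -{1}(xphi p).
by rewrite (reindex _ (onW_bij _ (@enum_val_bij I))).
Qed.

Lemma dual_basis_projective P (I : finType) (x : I -> P)
    (phi : I -> {linear P -> right_regular R}) :
  dual_basis x phi -> projective P.
Proof.
move=> xphi M N g f g_surj.
have [m gm] := choice (fun i => g_surj (f (x i))).
(* The lift expands [p] in the dual basis, with lifts [m i] of [f (x i)] in place of the [x i]. *)
pose h p := \sum_i ract (m i) (phi i p).
have hD p q : h (p + q) = h p + h q.
  rewrite -big_split; apply: eq_bigr => i _ /=.
  by rewrite (raddfD (phi i)) ractDr.
have hZ p a : h (ract p a) = ract (h p) a.
  rewrite ract_suml; apply: eq_bigr => i _.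
  by rewrite linear_regular ractA.
exists (mklinear hD hZ) => p; rewrite mklinearE -[in RHS](xphi p) !raddf_sum.
by apply: eq_bigr => i _ /=; rewrite !linear_ract gm.
Qed.

(** Generators give a surjection from the free module R^n onto P. It splits because P is projective,
    and the coordinates of a splitting are the functionals. *)
Lemma projective_dual_basis P : finitely_generated P -> projective P ->
  exists (n : nat) (x : 'I_n -> P) (phi : 'I_n -> {linear P -> right_regular R}),
    dual_basis x phi.
Proof.
move=> [n [x x_gen]] P_proj.
pose F : rmodType R := {ffun 'I_n -> right_regular R}.
pose g (u : F) := \sum_i ract (x i) (u i).
have gD u v : g (u + v) = g u + g v.
  by rewrite -big_split; apply: eq_bigr => i _; rewrite ffunE ractDr.
have gZ u a : g (ract u a) = ract (g u) a.
  by rewrite ract_suml; apply: eq_bigr => i _; rewrite /ract ffunE scalerA.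
have [|h gh] := P_proj F P (mklinear gD gZ) idfun.
  move=> p; have [a ->] := x_gen p; exists [ffun i => a i].
  by apply: eq_bigr => i _; rewrite ffunE.
have hD i p q : h (p + q) i = h p i + h q i by rewrite raddfD ffunE.
have hZ i p a : h (ract p a) i = ract (h p i) a.
  by rewrite linear_ract /ract ffunE.
by exists n, x, (fun i => mklinear (hD i) (hZ i)).
Qed.

(** Any x is the sum of the x psi_j(y_j), and each term is a value of the map p |-> x psi_j(p) from
    P to M, on which [f] and [g] agree. *)
Lemma trace_one_generator P (J : finType)
    (psi : J -> {linear P -> right_regular R}) (y : J -> P) :
  trace_one psi y -> generator P.
Proof.
move=> psiy M N f g fg x.
have := fg ((regular_ract x \o _) : {linear P -> M}); rewrite /= => {}fg.
rewrite -(ract1 x) -psiy ract_sumr !raddf_sum; apply: eq_bigr => j _.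
exact: fg.
Qed.

(** * Quotient of a module by a submodule *)

Section Quotient.
Variables (M : rmodType R) (U : set M).
Hypothesis U_sub : submodule U.

Let Ub : {pred M} := fun x => `[< U x >].

Let UbP x : x \in Ub <-> U x.
Proof. by split=> /asboolP. Qed.

Fact submodule_zmod_closed : zmod_closed Ub.
Proof.
have [U0 UD UZ] := U_sub; split=> [|x y /UbP Ux /UbP Uy]; apply/UbP => //.
by apply: UD => //; have := UZ _ (- 1) Uy; rewrite /ract scaleN1r.
Qed.

#[local] HB.instance Definition _ :=
  GRing.isZmodClosed.Build M Ub submodule_zmod_closed.

Local Notation Q := (Quotient.quot (Ub : zmodClosed M)).

Let cls (x : M) : Q := \pi_Q%qT x.

Let cls_eq x y : cls x = cls y <-> U (x - y).
Proof.
rewrite -UbP (Quotient.idealrBE (Ub : zmodClosed M)).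
by split=> /eqP.
Qed.

Let clsD x y : cls (x + y) = cls x + cls y.
Proof. exact: (raddfD \pi_Q%qT). Qed.

Let scale (a : R^c) (q : Q) : Q := cls (a *: repr q).

Let scaleE a x : scale a (cls x) = cls (a *: x).
Proof.
have [_ _ UZ] := U_sub; apply/cls_eq; rewrite -scalerBr; apply: UZ.
by apply/cls_eq; rewrite /cls reprK.
Qed.

Let clsP (q : Q) : exists x, q = cls x.
Proof. by exists (repr q); rewrite /cls reprK. Qed.

Fact quotient_scalerA a b q : scale a (scale b q) = scale (a * b) q.
Proof. by have [x ->] := clsP q; rewrite !scaleE scalerA. Qed.

Fact quotient_scale1r : left_id 1 scale.
Proof. by move=> q; have [x ->] := clsP q; rewrite scaleE scale1r. Qed.

Fact quotient_scalerDr : right_distributive scale +%R.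
Proof.
move=> a p q; have [[x ->] [y ->]] := (clsP p, clsP q).
by rewrite -clsD !scaleE scalerDr clsD.
Qed.

Fact quotient_scalerDl q : {morph scale^~ q : a b / a + b}.
Proof. by move=> a b; have [x ->] := clsP q; rewrite !scaleE scalerDl clsD. Qed.

#[local] HB.instance Definition _ := GRing.Zmodule_isLmodule.Build R^c Q
  quotient_scalerA quotient_scale1r quotient_scalerDr quotient_scalerDl.

Lemma quotient_module :
  exists (N : rmodType R) (f : {linear M -> N}), forall x, f x = 0 <-> U x.
Proof.
have clsZ x (a : R) : cls (ract x a) = ract (cls x : (Q : rmodType R)) a.
  by rewrite /ract -scaleE.
exists Q, (mklinear clsD clsZ) => x; rewrite mklinearE -[x in U x]subr0 -cls_eq.
suff -> : cls 0 = 0 by [].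
by apply: (addrI (cls 0)); rewrite -clsD !addr0.
Qed.

End Quotient.

(** The values of all functionals on P span a right ideal [T]. The quotient map R -> R/T and the
    zero map agree after every map P -> R, so they are equal, and 1 lies in [T]. *)
Lemma generator_trace_one P : generator P ->
  exists (n : nat) (psi : 'I_n -> {linear P -> right_regular R}) (y : 'I_n -> P),
    trace_one psi y.
Proof.
move=> P_gen.
pose T (a : right_regular R) :=
  exists n (psi : 'I_n -> {linear P -> right_regular R}) (y : 'I_n -> P),
    \sum_j psi j (y j) = a.
have T_sub : submodule T.
  split=> [|a b [n [psi [y <-]]] [k [psi' [y' <-]]]|a b [n [psi [y <-]]]].
  - by exists 0, (fun=> \0), (fun=> 0); rewrite big_ord0.
  - exists (n + k)%N.
    exists (fun j => match split j with inl i => psi i | inr i => psi' i end).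
    exists (fun j => match split j with inl i => y i | inr i => y' i end).
    rewrite big_split_ord; congr (_ + _); apply: eq_bigr => i _.
      by rewrite (unsplitK (inl i)).
    by rewrite (unsplitK (inr i)).
  - exists n, psi, (fun j => ract (y j) b); rewrite ract_suml.
    by apply: eq_bigr => j _; rewrite linear_ract.
have [N [f fT]] := quotient_module T_sub.
have [|n [psi [y psiy]]] := (fT (1 : R)).1; last by exists n, psi, y.
apply: (P_gen _ _ f \0) => h p; rewrite /=; apply/fT.
by exists 1, (fun=> h), (fun=> p); rewrite big_ord1.
Qed.

Lemma progeneratorP P : progenerator P <->
  (exists (I : finType) (x : I -> P) (phi : I -> {linear P -> right_regular R}),
     dual_basis x phi) /\
  (exists (J : finType) (psi : J -> {linear P -> right_regular R}) (y : J -> P),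
     trace_one psi y).
Proof.
split=> [[P_fg P_proj P_gen]|[[I [x [phi xphi]]] [J [psi [y psiy]]]]].
  have [n [x [phi xphi]]] := projective_dual_basis P_fg P_proj.
  have [k [psi [y psiy]]] := generator_trace_one P_gen.
  by split; [exists 'I_n, x, phi | exists 'I_k, psi, y].
split; [exact: dual_basis_finitely_generated xphi
       | exact: dual_basis_projective xphi | exact: trace_one_generator psiy].
Qed.

End Progenerators.

(** * Hom between biprogenerators *)

Section Biprogenerators.
Variables (S R : pzRingType) (P : bimodType S R).

Definition lact_linear (s : S) : {linear P -> P} :=
  mklinear (lactDr s) (lact_ract s).

Lemma lact_suml (I : finType) (F : I -> S) (p : P) :
  lact (\sum_i F i) p = \sum_i lact (F i) p.
Proof.
apply: (big_morph (fun s => lact s p)) => [s t|]; first exact: lactDl.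
by apply: (addrI (lact 0 p)); rewrite -lactDl !addr0.
Qed.

Lemma lact_sumr (I : finType) (s : S) (F : I -> P) :
  lact s (\sum_i F i) = \sum_i lact s (F i).
Proof. exact: (linear_sum (lact_linear s)). Qed.

Hypothesis P_bi : biprogenerator P.

(** Faithfulness is the uniqueness half of being a biprogenerator. Equations in S are proved below
    by comparing actions on P. *)
Lemma lact_inj (s t : S) : (forall p : P, lact s p = lact t p) -> s = t.
Proof.
have [u [_ uU]] := P_bi.2 (lact_linear s) => st.
by rewrite -(uU s) ?(uU t).
Qed.

Definition lact_coef (f : {linear P -> P}) : S :=
  sval (cid (P_bi.2 f)).

Lemma lact_coefE f p : lact (lact_coef f) p = f p.
Proof. by rewrite /lact_coef; case: cid => s [/= ->]. Qed.

End Biprogenerators.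

Section Hom.
Variables (T S R : pzRingType) (Q : bimodType T R) (P : bimodType S R).

(** A separate name lets Hom(P, Q) carry its right S-module structure; its equality and choice
    structures are classical. *)
Definition bimod_hom := {linear P -> Q}.

HB.instance Definition _ := gen_eqMixin bimod_hom.
HB.instance Definition _ := gen_choiceMixin bimod_hom.

Definition hom_fun (h : bimod_hom) : {linear P -> Q} := h.
Definition hom_zero : bimod_hom := \0.
Definition hom_opp (h : bimod_hom) : bimod_hom := \- hom_fun h.
Definition hom_add (h k : bimod_hom) : bimod_hom := hom_fun h \+ hom_fun k.

Fact hom_addA : associative hom_add.
Proof. by move=> f g h; apply: linear_ext => p; apply: addrA. Qed.
Fact hom_addC : commutative hom_add.
Proof. by move=> f g; apply: linear_ext => p; apply: addrC. Qed.
Fact hom_add0 : left_id hom_zero hom_add.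
Proof. by move=> f; apply: linear_ext => p; apply: add0r. Qed.
Fact hom_addN : left_inverse hom_zero hom_opp hom_add.
Proof. by move=> f; apply: linear_ext => p; apply: addNr. Qed.

HB.instance Definition _ :=
  GRing.isZmodule.Build bimod_hom hom_addA hom_addC hom_add0 hom_addN.

Definition hom_ract (s : S^c) (h : bimod_hom) : bimod_hom :=
  hom_fun h \o lact_linear P s.

Fact hom_ractA s t h : hom_ract s (hom_ract t h) = hom_ract (s * t) h.
Proof. by apply: linear_ext => p /=; rewrite lactA. Qed.
Fact hom_ract1 : left_id 1 hom_ract.
Proof. by move=> h; apply: linear_ext => p /=; rewrite lact1. Qed.
Fact hom_ractDr : right_distributive hom_ract +%R.
Proof. by move=> s f g; apply: linear_ext. Qed.
Fact hom_ractDl h : {morph hom_ract^~ h : s t / s + t}.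
Proof. by move=> s t; apply: linear_ext => p /=; rewrite lactDl (raddfD h). Qed.

HB.instance Definition _ := GRing.Zmodule_isLmodule.Build S^c bimod_hom
  hom_ractA hom_ract1 hom_ractDr hom_ractDl.

Definition hom_lact (t : T) (h : bimod_hom) : bimod_hom :=
  lact_linear Q t \o hom_fun h.

Fact hom_lactA t u h : hom_lact t (hom_lact u h) = hom_lact (t * u) h.
Proof. by apply: linear_ext => p /=; apply: lactA. Qed.
Fact hom_lact1 h : hom_lact 1 h = h.
Proof. by apply: linear_ext => p /=; apply: lact1. Qed.
Fact hom_lactDl t u h : hom_lact (t + u) h = hom_lact t h + hom_lact u h.
Proof. by apply: linear_ext => p /=; apply: lactDl. Qed.
Fact hom_lactDr t h k : hom_lact t (h + k) = hom_lact t h + hom_lact t k.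
Proof. by apply: linear_ext => p /=; apply: lactDr. Qed.
Fact hom_lact_ract t (h : bimod_hom : rmodType S) (s : S) :
  hom_lact t (ract h s) = ract (hom_lact t h : bimod_hom : rmodType S) s.
Proof. exact: linear_ext. Qed.

Definition hom_bimod : bimodType T S :=
  Bimod hom_lactA hom_lact1 hom_lactDl hom_lactDr hom_lact_ract.

Lemma hom_sumE (I : finType) (F : I -> bimod_hom) (p : P) :
  hom_fun (\sum_i F i) p = \sum_i hom_fun (F i) p.
Proof. by apply: (big_morph (fun h => hom_fun h p)). Qed.

Lemma hom_ractE (h : hom_bimod) (s : S) (p : P) :
  hom_fun (ract h s) p = hom_fun h (lact s p).
Proof. by []. Qed.

Lemma hom_lactE (h : hom_bimod) (t : T) (p : P) :
  hom_fun (lact t h) p = lact t (hom_fun h p).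
Proof. by []. Qed.

Definition rank_one (M N : rmodType R) (y : N)
  (psi : {linear M -> right_regular R}) :
  {linear M -> N} := regular_ract y \o psi.

Hypotheses (P_bi : biprogenerator P) (Q_bi : biprogenerator Q).

Section Coordinate.
Variables (x : P) (phi : {linear Q -> right_regular R}).

(** The map p |-> x phi(h(p)) is an endomorphism of P, hence an element of S. So a functional on Q
    and a point of P yield a functional on Hom(P, Q). *)
Definition hom_coord_fun (h : hom_bimod) : right_regular S :=
  lact_coef P_bi (rank_one x phi \o hom_fun h).

Fact hom_coord_funD h k :
  hom_coord_fun (h + k) = hom_coord_fun h + hom_coord_fun k.
Proof.
apply: (lact_inj P_bi) => p; rewrite lactDl !lact_coefE /=.
by rewrite (raddfD phi) ractDr.
Qed.

Fact hom_coord_funZ h (s : S) :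
  hom_coord_fun (ract h s) = ract (hom_coord_fun h) s.
Proof. by apply: (lact_inj P_bi) => p; rewrite -lactA !lact_coefE. Qed.

Definition hom_coord : {linear hom_bimod -> right_regular S} :=
  mklinear hom_coord_funD hom_coord_funZ.

Lemma hom_coordE (h : hom_bimod) (p : P) :
  lact (hom_coord h : S) p = ract x (phi (hom_fun h p)).
Proof. exact: lact_coefE. Qed.

End Coordinate.

(** Insert 1 = sum_j psi_j(x_j) into h(p) = sum_i y_i phi_i(h(p)): the terms become y_i psi_j(x_j
    phi_i(h(p))). *)
Lemma hom_dual_basis (I J : finType) (y : I -> Q)
    (phi : I -> {linear Q -> right_regular R})
    (psi : J -> {linear P -> right_regular R}) (x : J -> P) :
  dual_basis y phi -> trace_one psi x ->
  dual_basis (fun ij : I * J => rank_one (y ij.1) (psi ij.2) : hom_bimod)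
    (fun ij => hom_coord (x ij.2) (phi ij.1)).
Proof.
move=> yphi psix h; apply: linear_ext => p.
rewrite [LHS]hom_sumE -[RHS]/(hom_fun h p) -[RHS]yphi.
rewrite -(pair_bigA _ (fun i j => hom_fun (ract (rank_one (y i) (psi j) : hom_bimod)
  (hom_coord (x j) (phi i) h)) p)) /=.
apply: eq_bigr => i _; rewrite -[phi i _ in RHS](@mul1r R).
rewrite -[X in X * _]psix mulr_suml ract_sumr.
by apply: eq_bigr => j _; rewrite (hom_coordE (x j) (phi i)) linear_regular.
Qed.

(** The sum acts on P by p |-> sum x_i psi_j(y_j) phi_i(p), which is the identity. *)
Lemma hom_trace_one (I J : finType) (x : I -> P)
    (phi : I -> {linear P -> right_regular R})
    (psi : J -> {linear Q -> right_regular R}) (y : J -> Q) :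
  dual_basis x phi -> trace_one psi y ->
  trace_one (fun ij : I * J => hom_coord (x ij.1) (psi ij.2))
    (fun ij => rank_one (y ij.2) (phi ij.1) : hom_bimod).
Proof.
move=> xphi psiy; apply: (lact_inj P_bi) => p.
rewrite lact_suml lact1 -[RHS]xphi.
rewrite -(pair_bigA _ (fun i j => lact (hom_coord (x i) (psi j)
  (rank_one (y j) (phi i) : hom_bimod) : S) p)) /=.
apply: eq_bigr => i _; rewrite -[phi i p in RHS](@mul1r R).
rewrite -[X in X * _]psiy mulr_suml ract_sumr.
by apply: eq_bigr => j _; rewrite (hom_coordE (x i) (psi j)) linear_regular.
Qed.

Lemma hom_biprogenerator : biprogenerator hom_bimod.
Proof.
have [[I [x [phi xphi]]] [I' [psi [y psiy]]]] := (progeneratorP P).1 P_bi.1.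
have [[J [u [chi uchi]]] [J' [om [v omv]]]] := (progeneratorP Q).1 Q_bi.1.
have basis := hom_dual_basis uchi psiy.
split.
  apply/progeneratorP; split.
    by exists (J * I')%type; do 2 eexists; exact: basis.
  by exists (I * J')%type; do 2 eexists; exact: (hom_trace_one xphi omv).
move=> F.
(* Expanding [h] in the dual basis of Hom(P, Q) shows F(h) = g o h. As an endomorphism of Q, [g] is
   the action of some [t]. *)
pose g (q : Q) : Q := \sum_(ij : J * I')
  hom_fun (F (rank_one (u ij.1) (psi ij.2) : hom_bimod))
    (ract (y ij.2) (chi ij.1 q)).
have gD p q : g (p + q) = g p + g q.
  rewrite -big_split; apply: eq_bigr => ij _ /=.
  by rewrite raddfD ractDr raddfD.
have gZ p a : g (ract p a) = ract (g p) a.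
  rewrite ract_suml; apply: eq_bigr => ij _.
  by rewrite linear_regular -ractA linear_ract.
have [t [tE tU]] := Q_bi.2 (mklinear gD gZ).
exists t; split=> [h|t' t'E].
  apply: linear_ext => p; rewrite -[RHS]/(hom_fun (lact t h) p) hom_lactE -tE.
  rewrite mklinearE -[h in LHS]basis linear_sum [LHS]hom_sumE.
  apply: eq_bigr => ij _; rewrite (linear_ract F) hom_ractE.
  by rewrite hom_coordE.
(* If [F] is the action of [t'], the terms of g(q) are t' u_i psi_j(y_j) chi_i(q), with sum t' q. *)
apply: tU => q; rewrite mklinearE -[q in RHS]uchi lact_sumr.
transitivity (\sum_i \sum_j hom_fun (F (rank_one (u i) (psi j) : hom_bimod))
  (ract (y j) (chi i q))); first by rewrite pair_bigA.
apply: eq_bigr => i _; rewrite -[chi i q in RHS](@mul1r R).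
rewrite -[X in X * _]psiy mulr_suml ract_sumr lact_sumr.
by apply: eq_bigr => j _; rewrite t'E hom_lactE /= linear_regular.
Qed.

End Hom.

(** * The opposite bimodule *)

Section Opposite.
Variables (S R : pzRingType) (P : bimodType S R).

Definition op_sort : Type := P.
HB.instance Definition _ := GRing.Zmodule.on op_sort.

(* A right S^c-module is a module over (S^c)^c, that is, a left S-module. *)
Definition op_scale (s : (S^c)^c) (p : op_sort) : op_sort := lact (s : S) (p : P).

Fact op_scaleA s t p : op_scale s (op_scale t p) = op_scale (s * t) p.
Proof. exact: lactA. Qed.
Fact op_scale1 : left_id 1 op_scale.
Proof. exact: lact1. Qed.
Fact op_scaleDr : right_distributive op_scale +%R.
Proof. by move=> s p q; apply: lactDr. Qed.
Fact op_scaleDl p : {morph op_scale^~ p : s t / s + t}.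
Proof. by move=> s t; apply: lactDl. Qed.

HB.instance Definition _ := GRing.Zmodule_isLmodule.Build (S^c)^c op_sort
  op_scaleA op_scale1 op_scaleDr op_scaleDl.

Definition op_mod : rmodType S^c := op_sort.
Definition op_lact (r : R^c) (p : op_mod) : op_mod := ract (p : P) (r : R).

Fact op_lactA r t p : op_lact r (op_lact t p) = op_lact (r * t) p.
Proof. exact: (@ractA R P). Qed.
Fact op_lact1 p : op_lact 1 p = p.
Proof. exact: (@ract1 R P). Qed.
Fact op_lactDl r t p : op_lact (r + t) p = op_lact r p + op_lact t p.
Proof. exact: (@ractDr R P). Qed.
Fact op_lactDr r p q : op_lact r (p + q) = op_lact r p + op_lact r q.
Proof. exact: (@ractDl R P). Qed.
Fact op_lact_ract r p (s : S^c) : op_lact r (ract p s) = ract (op_lact r p) s.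
Proof. exact: (esym (lact_ract (s : S) (p : P) (r : R))). Qed.

Definition op_bimod : bimodType R^c S^c :=
  Bimod op_lactA op_lact1 op_lactDl op_lactDr op_lact_ract.

Hypothesis P_bi : biprogenerator P.

Section Coordinate.
Variable psi : {linear P -> right_regular R}.

(** The rank one map x |-> p psi(x) read as an element of S, so that functionals on P_R become
    functionals on the left S-module P. *)
Definition op_coord_fun (p : op_mod) : right_regular S^c :=
  lact_coef P_bi (rank_one (p : P) psi).

Fact op_coord_funD p q : op_coord_fun (p + q) = op_coord_fun p + op_coord_fun q.
Proof.
by apply: (lact_inj P_bi) => x; rewrite lactDl !lact_coefE /= (@ractDl R P).
Qed.

Fact op_coord_funZ p (s : S^c) : op_coord_fun (ract p s) = ract (op_coord_fun p) s.
Proof.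
apply: (lact_inj P_bi) => x.
transitivity (lact (s : S) (lact (op_coord_fun p : S) x)); last exact: lactA.
by rewrite !lact_coefE /= lact_ract.
Qed.

Definition op_coord : {linear op_mod -> right_regular S^c} :=
  mklinear op_coord_funD op_coord_funZ.

Lemma op_coordE (p x : P) : lact (op_coord p : S) x = ract p (psi x).
Proof. exact: lact_coefE. Qed.

End Coordinate.

(** Passing to the other side exchanges the two kinds of data: trace one over R gives a dual basis
    over S, and a dual basis over R gives trace one over S. A left S-linear [F] is then right
    multiplication by sum_j psi_j(F(y_j)). *)
Lemma op_biprogenerator : biprogenerator op_bimod.
Proof.
have [[I [x [phi xphi]]] [J [psi [y psiy]]]] := (progeneratorP P).1 P_bi.1.
have basis (p : P) : \sum_j lact (op_coord (psi j) p : S) (y j) = p.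
  rewrite -[RHS]ract1 -psiy ract_sumr.
  by apply: eq_bigr => j _; rewrite op_coordE.
split.
  apply/progeneratorP; split; first by exists J, y, (fun j => op_coord (psi j)).
  exists I, (fun i => op_coord (phi i)), x; apply: (lact_inj P_bi) => p.
  rewrite lact_suml lact1 -[RHS]xphi.
  by apply: eq_bigr => i _; rewrite op_coordE.
move=> F; pose r : R := \sum_j psi j (F (y j)).
exists r; split=> [p|r' r'E].
  rewrite -[p in LHS]basis linear_sum -[RHS]/(ract (p : P) r) ract_sumr.
  apply: eq_bigr => j _; rewrite -op_coordE.
  exact: (linear_ract F (y j)).
rewrite /r -[RHS](@mul1r R) -[X in X * _]psiy mulr_suml.
by apply: eq_bigr => j _; rewrite r'E -linear_regular.
Qed.

End Opposite.

(** * The regular module with left action through a ring morphism *)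

Section Twist.
Variables (S R : pzRingType) (theta : {rmorphism S -> R}).

Definition twist_lact (s : S) (x : right_regular R) : right_regular R :=
  theta s * (x : R).

Fact twist_lactA s t x : twist_lact s (twist_lact t x) = twist_lact (s * t) x.
Proof. by rewrite /twist_lact rmorphM mulrA. Qed.
Fact twist_lact1 x : twist_lact 1 x = x.
Proof. by rewrite /twist_lact rmorph1 mul1r. Qed.
Fact twist_lactDl s t x : twist_lact (s + t) x = twist_lact s x + twist_lact t x.
Proof. by rewrite /twist_lact rmorphD mulrDl. Qed.
Fact twist_lactDr s x y : twist_lact s (x + y) = twist_lact s x + twist_lact s y.
Proof. exact: (@mulrDr R). Qed.
Fact twist_lact_ract s x (a : R) :
  twist_lact s (ract x a) = ract (twist_lact s x) a.
Proof. exact: (@mulrA R). Qed.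

Definition twist_bimod : bimodType S R :=
  Bimod twist_lactA twist_lact1 twist_lactDl twist_lactDr twist_lact_ract.

Lemma twist_biprogenerator : bijective theta -> biprogenerator twist_bimod.
Proof.
move=> [theta' thetaK theta'K]; split.
  apply/progeneratorP; split.
    exists 'I_1, (fun=> 1 : R), (fun=> idfun) => p; rewrite big_ord1.
    exact: (@mul1r R).
  by exists 'I_1, (fun=> idfun), (fun=> 1 : R); rewrite /trace_one big_ord1.
move=> f; exists (theta' (f (1 : R) : R)); split=> [p|s fs].
  by rewrite linear_regular1 /= /twist_lact theta'K.
by rewrite fs /= /twist_lact mulr1 thetaK.
Qed.

End Twist.

(** * Morita equivalences of a given type *)

Section Types.
Variable C : comPzRingType.
Implicit Types R S T : centralAlgType C.

Lemma progenerator_of_type_ext S R (sigma tau : C -> C) : sigma =1 tau ->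
  progenerator_of_type S R sigma -> progenerator_of_type S R tau.
Proof. by move=> /funext ->. Qed.

Lemma progenerator_of_type_iso S R (theta : {rmorphism S -> R}) (sigma : C -> C) :
  bijective theta -> (forall c, theta (calg_in S (sigma c)) = calg_in R c) ->
  progenerator_of_type S R sigma.
Proof.
move=> theta_bij theta_in; exists (twist_bimod theta).
  exact: twist_biprogenerator.
move=> p c; rewrite /= /twist_lact theta_in.
have cR : central (calg_in R c) by apply/calg_centerP; exists c.
exact: cR p.
Qed.

(** On h(p), sigma(rho'(c)) acts as rho'(c) on the right. Moved inside [h], this becomes the left
    action of rho(rho'(c)) = c on p. *)
Lemma progenerator_of_type_hom S T R (rho rho' sigma : C -> C) :
  cancel rho' rho -> progenerator_of_type S R rho ->
  progenerator_of_type T R sigma -> progenerator_of_type T S (sigma \o rho').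
Proof.
move=> rhoK [P P_bi P_rho] [Q Q_bi Q_sigma].
exists (hom_bimod Q P); first exact: hom_biprogenerator.
move=> h c; apply: linear_ext => p.
rewrite -[LHS]/(hom_fun (lact _ (h : hom_bimod Q P)) p) hom_lactE.
rewrite -[RHS]/(hom_fun (ract (h : hom_bimod Q P) _) p) hom_ractE.
by rewrite -[c in RHS]rhoK P_rho linear_ract /= Q_sigma.
Qed.

(** The inverse equivalence is given by the dual Hom(P, R). *)
Lemma progenerator_of_type_sym S R (rho rho' : C -> C) :
  cancel rho' rho -> progenerator_of_type S R rho ->
  progenerator_of_type R S rho'.
Proof.
move=> rhoK SR; apply: progenerator_of_type_ext (_ : id \o rho' =1 rho') _ => //.
apply: progenerator_of_type_hom rhoK SR _.
by apply: (@progenerator_of_type_iso _ _ idfun); first exists idfun.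
Qed.

(** Hom over S from the dual of P to Q stands in for the tensor product of Q and P over S. *)
Lemma progenerator_of_type_trans S R T (rho rho' sigma : C -> C) :
  cancel rho rho' -> cancel rho' rho -> progenerator_of_type T S sigma ->
  progenerator_of_type S R rho -> progenerator_of_type T R (sigma \o rho).
Proof.
move=> rhoK rho'K TS SR; apply: progenerator_of_type_hom rhoK _ TS.
exact: progenerator_of_type_sym rho'K SR.
Qed.

Lemma progenerator_of_type_op S R :
  progenerator_of_type S R id -> progenerator_of_type (calg_op R) (calg_op S) id.
Proof.
move=> [P P_bi P_id]; exists (op_bimod P); first exact: op_biprogenerator.
by move=> p c; apply: (esym (P_id p c)).
Qed.

Lemma morita_equivalent_to_op_invariant R S (sigma : C -> C) :
  bijective sigma -> morita_equivalent_over R S ->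
  morita_equivalent_to_op R sigma <-> morita_equivalent_to_op S sigma.
Proof.
(* The composite runs from A^op through B^op and B to A, and only the middle step has a type other
   than id. *)
have half (A B : centralAlgType C) : bijective sigma ->
    progenerator_of_type A B id -> progenerator_of_type (calg_op B) B sigma ->
    progenerator_of_type (calg_op A) A sigma.
  move=> [sigma' sigmaK sigma'K] AB BB.
  have BA : progenerator_of_type B A id by apply: progenerator_of_type_sym AB.
  have AB' := progenerator_of_type_op BA.
  have AB'' := progenerator_of_type_trans sigmaK sigma'K AB' BB.
  have idK : cancel (@id C) id by [].
  exact: (progenerator_of_type_trans idK idK AB'' BA).
move=> sigma_bij SR; split; first exact: half sigma_bij SR.
by apply: half sigma_bij _; apply: progenerator_of_type_sym SR.
Qed.

Lemma anti_automorphism_morita S (sigma : C -> C) :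
  has_anti_automorphism S sigma -> morita_equivalent_to_op S sigma.
Proof.
move=> [tau [tau_bij tau_in]].
have [tau' tauK tau'K] := tau_bij.
have tau'_zmod : zmod_morphism (tau' : calg_op S -> S).
  by move=> x y; apply: (can_inj tauK); rewrite rmorphB !tau'K.
have tau'_monoid : monoid_morphism (tau' : calg_op S -> S).
  split=> [|x y]; apply: (can_inj tauK); first by rewrite rmorph1 tau'K.
  by rewrite rmorphM !tau'K.
pose theta : {rmorphism calg_op S -> S} := HB.pack (tau' : calg_op S -> S)
  (GRing.isZmodMorphism.Build _ _ _ tau'_zmod)
  (GRing.isMonoidMorphism.Build _ _ _ tau'_monoid).
apply: (progenerator_of_type_iso (theta := theta)); first by exists tau.
by move=> c /=; rewrite /calg_op_in -tau_in tauK.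
Qed.

(** [tau s] is the element of S^op acting on Q as left multiplication by s acts on S, transported
    along the isomorphism [g]. *)
Lemma regular_anti_automorphism S (sigma : C -> C) (Q : bimodType (calg_op S) S) :
  biprogenerator Q -> has_type Q sigma -> isomorphic (right_regular S) Q ->
  has_anti_automorphism S sigma.
Proof.
move=> Q_bi Q_sigma [g [g' gK g'K]].
have [h [gh hg]] := linear_inverse (Bijective gK g'K).
have gE s x : g (s * x : S) = ract (g s) x by exact: (linear_ract g s x).
pose tau (s : S) : calg_op S := lact_coef Q_bi
  (g \o lact_linear (twist_bimod (idfun : {rmorphism S -> S})) s \o h).
have tauE (s x : S) : lact (tau s) (g x) = g (s * x : S).
  by rewrite lact_coefE /= gh.
have tau_uniq (s : S) (r : calg_op S) :
    (forall x : S, lact r (g x) = g (s * x : S)) -> tau s = r.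
  by move=> rE; apply: (lact_inj Q_bi) => q; rewrite -(hg q) tauE rE.
have tauD : nmod_morphism tau.
  split=> [|s t]; apply: tau_uniq => x.
    rewrite mul0r (linear0 g).
    by apply: (addrI (lact 0 (g x))); rewrite -lactDl !addr0.
  by rewrite lactDl !tauE -linearD mulrDl.
have tauM : monoid_morphism tau.
  split=> [|s t]; apply: tau_uniq => x; first by rewrite lact1 mul1r.
  by rewrite -lactA !tauE mulrA.
pose tau_rmorphism : {rmorphism S -> S^c} := HB.pack (tau : S -> S^c)
  (GRing.isNmodMorphism.Build _ _ _ tauD)
  (GRing.isMonoidMorphism.Build _ _ _ tauM).
exists tau_rmorphism; split; last first.
  (* For c central, g(c x) = g(x c) = g(x) c, and the type of Q turns this into sigma(c) g(x). *)
  move=> c; apply: tau_uniq => x.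
  have cS : central (calg_in S c) by apply/calg_centerP; exists c.
  by rewrite (cS x) gE Q_sigma.
have g_ract (x : S) : g x = ract (g (1 : S)) x by rewrite -gE mul1r.
exists (fun r : S^c => h (lact (r : calg_op S) (g (1 : S)))) => [s|r] /=.
  by rewrite tauE mulr1 gh.
apply: tau_uniq => x; rewrite g_ract lact_ract.
by rewrite gE hg.
Qed.

End Types.

(** * Direct sum decompositions *)

Section Summands.
Variable R : pzRingType.
Implicit Types M N : rmodType R.

(** Complementary submodules are the image and kernel of an idempotent endomorphism. In this form
    indecomposability can be carried through [dual_hom]. *)
Lemma indecomposableP M : indecomposable M <->
  (exists x : M, x <> 0) /\
  (forall E : {linear M -> M}, (forall x, E (E x) = E x) ->
     (forall x, E x = 0) \/ (forall x, E x = x)).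
Proof.
split=> [[M0 M_indec]|[M0 M_idem]]; split=> //.
  move=> E EE.
  have [|||U0|V0] := M_indec (fun x => E x = x) (fun x => E x = 0).
  - split=> [|x y Ex Ey|x a Ex]; first exact: linear0.
      by rewrite linearD Ex Ey.
    by rewrite linear_ract Ex.
  - split=> [|x y Ex Ey|x a Ex]; first exact: linear0.
      by rewrite linearD Ex Ey addr0.
    by rewrite linear_ract Ex /ract scaler0.
  - split=> [x Ex Ex0|x]; first by rewrite -Ex.
    exists (E x), (x - E x).
    by rewrite linearB !EE subrr addrC subrK.
  - by left=> x; apply: U0.
  - by right=> x; apply/esym/subr0_eq; apply: V0; rewrite linearB EE subrr.
move=> U V [U0 UD UZ] [V0 VD VZ] [UV0 UV].
have VN x : V x -> V (- x).
  by move=> Vx; have := VZ _ (- 1) Vx; rewrite /ract scaleN1r.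
have UN x : U x -> U (- x).
  by move=> Ux; have := UZ _ (- 1) Ux; rewrite /ract scaleN1r.
(* [E] will be the projection onto [U] along [V]; uniqueness of the decomposition makes it
   linear. *)
have E_ex x : exists u, U u /\ V (x - u).
  by have [u [v [Uu Vv ->]]] := UV x; exists u; rewrite addrC addKr.
have [E EP] := choice E_ex.
have E_uniq x u : U u -> V (x - u) -> E x = u.
  move=> Uu Vu; have [UEx VEx] := EP x; apply/eqP; rewrite -subr_eq0; apply/eqP.
  apply: UV0; first by apply: UD => //; apply: UN.
  have -> : E x - u = (x - u) - (x - E x).
    by rewrite opprB [RHS]addrC addrA subrK.
  by apply: VD => //; apply: VN.
have ED x y : E (x + y) = E x + E y.
  have [[UEx VEx] [UEy VEy]] := (EP x, EP y).
  by apply: E_uniq; [apply: UD | rewrite opprD addrACA; apply: VD].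
have EZ x a : E (ract x a) = ract (E x) a.
  have [UEx VEx] := EP x.
  by apply: E_uniq; [apply: UZ | rewrite /ract -scalerBr; apply: VZ].
have EU x : U x -> E x = x by move=> Ux; apply: E_uniq; rewrite ?subrr.
have [x|E0|E1] := M_idem (mklinear ED EZ); first exact: EU (EP x).1.
  by left=> x Ux; rewrite -(EU x Ux); apply: E0.
right=> x Vx; rewrite -(E_uniq x 0) ?subr0 //; exact/esym/E1.
Qed.

Section FixedPoints.
Variables (M : rmodType R) (E : {linear M -> M}).

Definition fixed_pred : {pred M} := fun x => E x == x.

Fact fixed_pred_submod : submod_closed fixed_pred.
Proof.
split=> [|a x y /eqP Ex /eqP Ey]; first by rewrite /in_mem /= /fixed_pred linear0.
by apply/eqP; rewrite linearP Ex Ey.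
Qed.

(** For idempotent [E] this is the image of [E], a direct summand of M. *)
Record fixed_points : Type :=
  MkFixed { fixed_val : M; _ : fixed_val \in fixed_pred }.

HB.instance Definition _ := [isSub for fixed_val].
HB.instance Definition _ := [Choice of fixed_points by <:].
HB.instance Definition _ :=
  GRing.SubChoice_isSubLmodule.Build R^c M fixed_pred fixed_points
    fixed_pred_submod.

Definition fixed_incl : {linear fixed_points -> M} := val.

Lemma fixed_inclE x : E (fixed_incl x) = fixed_incl x.
Proof. exact: eqP (valP x). Qed.

Hypothesis E_idem : forall x, E (E x) = E x.

Definition fixed_proj_fun (x : M) : fixed_points := MkFixed (introT eqP (E_idem x)).

Fact fixed_proj_funD x y :
  fixed_proj_fun (x + y) = fixed_proj_fun x + fixed_proj_fun y.
Proof. by apply: val_inj; rewrite /= linearD. Qed.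

Fact fixed_proj_funZ x a :
  fixed_proj_fun (ract x a) = ract (fixed_proj_fun x : fixed_points) a.
Proof. by apply: val_inj; rewrite /= linear_ract. Qed.

Definition fixed_proj : {linear M -> fixed_points} :=
  mklinear fixed_proj_funD fixed_proj_funZ.

Lemma fixed_inclK : cancel fixed_incl fixed_proj.
Proof. by move=> x; apply: val_inj; apply: fixed_inclE. Qed.

End FixedPoints.

Definition biproduct M (t : nat) (N : 'I_t -> rmodType R)
    (f : forall i, {linear N i -> M}) (g : forall i, {linear M -> N i}) : Prop :=
  [/\ forall i, cancel (f i) (g i),
      forall i j x, i != j -> g i (f j x) = 0
    & forall x, \sum_i f i (g i x) = x].

(** The projections are components obtained by choice; uniqueness of components makes them
    linear. *)
Lemma direct_sum_biproduct M (t : nat) (N : 'I_t -> rmodType R) :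
  is_direct_sum M N -> exists f g, @biproduct M t N f g.
Proof.
move=> [f [f_surj f_inj]]; have [p pE] := choice f_surj.
have p_uniq (q r : forall i, N i) :
    \sum_i f i (q i) = \sum_i f i (r i) -> forall i, q i = r i.
  move=> /eqP; rewrite -subr_eq0 -sumrB => /eqP qr i; apply/eqP; rewrite -subr_eq0.
  apply/eqP; apply: (f_inj (fun i => q i - r i)).
  by rewrite -[RHS]qr; apply: eq_bigr => j _; rewrite linearB.
have pD i x y : p (x + y) i = p x i + p y i.
  apply: (p_uniq _ (fun i => p x i + p y i)).
  rewrite -pE [in LHS](pE x) [in LHS](pE y).
  by rewrite -big_split; apply: eq_bigr => j _; rewrite linearD.
have pZ i x a : p (ract x a) i = ract (p x i) a.
  apply: (p_uniq _ (fun i => ract (p x i) a)); rewrite -pE [in LHS](pE x).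
  by rewrite ract_suml; apply: eq_bigr => j _; rewrite linear_ract.
(* The family with [x] in place i and 0 elsewhere; the cast moves [x] from [N i] to [N j] when i =
   j. *)
pose single i (x : N i) j : N j :=
  if i =P j is ReflectT e then ecast k (N k) e x else 0.
have singleE i x : \sum_j f j (@single i x j) = f i x.
  rewrite (bigD1 i) //= big1 ?addr0 => [|j ij].
    by rewrite /single; case: eqP => // e; rewrite eq_axiomK.
  by rewrite /single; case: eqP => [e|_]; [rewrite e eqxx in ij | rewrite linear0].
exists f, (fun i => mklinear (pD i) (pZ i)); split=> [i x|i j x ij|x] /=.
- rewrite (p_uniq _ (single i x)) ?singleE -?pE //.
  by rewrite /single; case: eqP => // e; rewrite eq_axiomK.
- rewrite (p_uniq _ (single j x)) ?singleE -?pE //.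
  by rewrite /single; case: eqP => // e; rewrite e eqxx in ij.
- by rewrite -pE.
Qed.

Lemma biproduct_isomorphic M M' (t : nat) (N N' : 'I_t -> rmodType R) f g f' g'
    (s : 'I_t -> 'I_t) :
  @biproduct M t N f g -> @biproduct M' t N' f' g' -> injective s ->
  (forall i, isomorphic (N' i) (N (s i))) -> isomorphic M M'.
Proof.
move=> [fK fg0 fg1] [f'K f'g'0 f'g'1] s_inj iso.
pose w i := sval (cid (iso i)).
have w_bij i : bijective (w i) := svalP (cid (iso i)).
pose v i := sval (cid (linear_inverse (w_bij i))).
have wK i : cancel (w i) (v i) := (svalP (cid (linear_inverse (w_bij i)))).1.
have vK i : cancel (v i) (w i) := (svalP (cid (linear_inverse (w_bij i)))).2.
pose F x := \sum_i f' i (v i (g (s i) x)).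
pose G y := \sum_i f (s i) (w i (g' i y)).
have FD x y : F (x + y) = F x + F y.
  by rewrite -big_split; apply: eq_bigr => i _ /=; rewrite !linearD.
have FZ x a : F (ract x a) = ract (F x) a.
  by rewrite ract_suml; apply: eq_bigr => i _; rewrite !linear_ract.
exists (mklinear FD FZ), G => [x|y]; rewrite mklinearE.
  (* An injective self-map of a finite type is a permutation, so the sum over all summands of M may
     be reindexed along [s]. *)
  rewrite -[RHS]fg1 [RHS](reindex_inj s_inj); apply: eq_bigr => i _ /=.
  rewrite linear_sum (bigD1 i) //= f'K big1 ?addr0 ?vK // => j ji.
  by rewrite f'g'0 // eq_sym.
rewrite -[RHS]f'g'1; apply: eq_bigr => i _ /=.
rewrite linear_sum (bigD1 i) //= fK big1 ?addr0 ?wK // => j ji.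
by rewrite fg0 // (inj_eq s_inj) eq_sym.
Qed.

End Summands.

(** * Progenerators over a basic ring *)

Section Basic.
Variable S : pzRingType.

Lemma multiplicities1_direct_sum (t : nat) (P : 'I_t -> rmodType S)
    (m : 'I_t -> nat) :
  multiplicities P m -> (forall i, m i = 1%N) -> is_direct_sum (right_regular S) P.
Proof.
move=> + m1; have -> : m = fun=> 1%N by apply/funext.
move=> [f [f_surj f_inj]].
pose g i (x : P i) : right_regular S := f i [ffun=> x].
have gD i x y : g i (x + y) = g i x + g i y.
  by rewrite /g -linearD; congr (f i _); apply/ffunP => k; rewrite !ffunE.
have gZ i x a : g i (ract x a) = ract (g i x) a.
  by rewrite /g -linear_ract; congr (f i _); apply/ffunP => k; rewrite /ract !ffunE.
exists (fun i => mklinear (gD i) (gZ i)); split=> [x|p p0 i].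
  have [p ->] := f_surj x; exists (fun i => p i ord0).
  apply: eq_bigr => i _; congr (f i _); apply/ffunP => k.
  by rewrite ffunE [k]ord1.
by have /ffunP/(_ ord0) := f_inj (fun i => [ffun=> p i]) p0 i; rewrite !ffunE.
Qed.

Variables (t : nat) (P : 'I_t -> rmodType S).
Variables (f : forall i, {linear P i -> right_regular S})
          (g : forall i, {linear right_regular S -> P i}).
Hypotheses (P_indec : indec_projectives P) (fg : biproduct f g).
Variable (Q : bimodType S^c S).
Hypothesis Q_bi : biprogenerator Q.

(** Left multiplication by e_i is the projection of S_S onto the copy of P_i, so P_i is e_i S; the
    e_i are orthogonal idempotents with sum 1. *)
Let e i : S := f i (g i (1 : S)).

Let eE i (x : S) : f i (g i x) = e i * x :> S.
Proof.
by rewrite [x in LHS](esym (mul1r x)) (linear_ract (g i) (1 : S) x) linear_ract.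
Qed.

Let e_idem i : e i * e i = e i.
Proof. by have [fK _ _] := fg; rewrite -eE fK. Qed.

Let e_orth i j : i != j -> e i * e j = 0.
Proof. by have [_ fg0 _] := fg => ij; rewrite -eE fg0 // linear0. Qed.

Let e_sum : \sum_i e i = 1.
Proof. by have [_ _ fg1] := fg; apply: fg1. Qed.

Let E i : {linear Q -> Q} := lact_linear Q (e i : S^c).

Let E_idem i x : E i (E i x) = E i x.
Proof. by rewrite /= lactA; congr (lact _ x); apply: e_idem. Qed.

Let N i : rmodType S := fixed_points (E i).
Let incl i : {linear N i -> Q} := fixed_incl (E i).
Let proj i : {linear Q -> N i} := fixed_proj (E_idem i).

Let inclK i : cancel (incl i) (proj i).
Proof. exact: fixed_inclK. Qed.

Let proj_biproduct : biproduct incl proj.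
Proof.
split=> [i|i j x ij|x]; first exact: inclK.
  apply: val_inj; rewrite -[LHS]/(E i (incl j x)) -fixed_inclE /= lactA.
  (* The product in S^op is e_j e_i in S, hence the exchanged indices. *)
  have -> : (e i : S^c) * e j = 0 by apply: e_orth; rewrite eq_sym.
  by apply: (addrI (lact 0 (incl j x))); rewrite -lactDl !addr0.
by rewrite -[RHS]lact1 -[1]e_sum lact_suml.
Qed.

Let coef i j (u : {linear N i -> N j}) : S :=
  lact_coef Q_bi (incl j \o u \o proj i).

(* u corresponds to an element of e_i S e_j, which acts from e_j S to e_i S. *)
Definition dual_hom i j (u : {linear N i -> N j}) : {linear P j -> P i} :=
  g i \o lact_linear (twist_bimod (idfun : {rmorphism S -> S})) (coef u) \o f j.

Let coefE i j (u : {linear N i -> N j}) q :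
  lact (coef u : S^c) q = incl j (u (proj i q)).
Proof. exact: lact_coefE. Qed.

Let coef_el i j (u : {linear N i -> N j}) : e i * coef u = coef u.
Proof.
apply: (lact_inj Q_bi) => q.
transitivity (lact (coef u : S^c) (E i q)); first exact: esym (lactA _ _ _).
rewrite !coefE; congr (incl j (u _)); apply: val_inj; exact: E_idem.
Qed.

Let coef_er i j (u : {linear N i -> N j}) : coef u * e j = coef u.
Proof.
apply: (lact_inj Q_bi) => q.
transitivity (E j (lact (coef u : S^c) q)); first exact: esym (lactA _ _ _).
by rewrite !coefE fixed_inclE.
Qed.

Let f_dual i j (u : {linear N i -> N j}) x :
  f i (dual_hom u x) = coef u * (f j x : S) :> S.
Proof. by rewrite eE /= /twist_lact mulrA coef_el. Qed.

Let f_inj i : injective (f i).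
Proof. by have [fK _ _] := fg; apply: can_inj (fK i). Qed.

Lemma dual_hom_comp i j k (u : {linear N i -> N j}) (v : {linear N j -> N k}) x :
  dual_hom (v \o u) x = dual_hom u (dual_hom v x).
Proof.
apply: f_inj; rewrite !f_dual mulrA; congr (_ * _).
apply: (lact_inj Q_bi) => q.
transitivity (lact (coef v : S^c) (lact (coef u : S^c) q)); last exact: lactA.
by rewrite !coefE inclK.
Qed.

Lemma dual_hom_id i x : dual_hom (idfun : {linear N i -> N i}) x = x.
Proof.
have [fK _ _] := fg; apply: f_inj; rewrite f_dual -[in RHS](fK i x) eE.
congr (_ * _); apply: (lact_inj Q_bi) => q; exact: coefE.
Qed.

Lemma dual_hom_zero i j x : dual_hom (\0 : {linear N i -> N j}) x = 0.
Proof.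
apply: f_inj; rewrite f_dual linear0 -[RHS](mul0r (f j x : S)); congr (_ * _).
apply: (lact_inj Q_bi) => q; rewrite coefE /=.
by apply: (addrI (lact 0 q)); rewrite -lactDl !addr0.
Qed.

(** [coef u] equals coef u e_j, which is read off from the value of [dual_hom u] at the element of
    P_j that corresponds to e_j. *)
Lemma dual_hom_inj i j (u v : {linear N i -> N j}) :
  dual_hom u =1 dual_hom v -> u =1 v.
Proof.
move=> uv x; have uv' : coef u = coef v.
  by rewrite -coef_er -[RHS]coef_er -!f_dual uv.
by apply: val_inj; rewrite -[x]inclK -[LHS]coefE uv' coefE.
Qed.

(** An idempotent of End(e_i Q) dualizes to an idempotent of End(P_i), which is 0 or 1, and
    [dual_hom] is injective. *)
Lemma fixed_indecomposable i : indecomposable (N i).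
Proof.
have [/(_ i)[_ _ /indecomposableP[[x x0] P_idem]] _ _] := P_indec.
apply/indecomposableP; split=> [|u uu].
  (* If e_i Q were 0, its identity and zero maps would coincide, hence also those of P_i. *)
  apply: contrapT => N0; apply: x0; rewrite -(dual_hom_id x) -(dual_hom_zero i x).
  congr (dual_hom _ x); apply: linear_ext => y /=.
  by apply: contrapT => y0; apply: N0; exists y.
have [y|u0|u1] := P_idem (dual_hom u).
- by rewrite -dual_hom_comp; congr (dual_hom _ y); apply: linear_ext.
- by left; apply: (@dual_hom_inj i i u \0) => y; rewrite u0 dual_hom_zero.
- by right; apply: (@dual_hom_inj i i u idfun) => y; rewrite u1 dual_hom_id.
Qed.

Lemma fixed_isomorphic_inj i j : isomorphic (N i) (N j) -> i = j.
Proof.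
have [_ P_inj _] := P_indec.
move=> [u /linear_inverse[v [uK vK]]]; apply/esym/P_inj; exists (dual_hom u).
exists (dual_hom v) => x; rewrite -dual_hom_comp -[RHS]dual_hom_id;
  by congr (dual_hom _ x); apply: linear_ext.
Qed.

(** Each e_i Q is a retract of Q, so it is finitely generated projective as well as indecomposable,
    hence isomorphic to some P_(s i). As the e_i Q are pairwise nonisomorphic, [s] is injective, and
    Q and S_S have the same summands up to order. *)
Lemma basic_progenerator_regular : isomorphic (right_regular S) Q.
Proof.
have [_ _ P_all] := P_indec.
have [[I [x [phi xphi]]] _] := (progeneratorP Q).1 Q_bi.1.
have N_P i : exists j, isomorphic (N i) (P j).
  have basis := dual_basis_retract xphi (@inclK i).
  apply: P_all (fixed_indecomposable i).
    exact: dual_basis_finitely_generated basis.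
  exact: dual_basis_projective basis.
have [s sP] := choice N_P.
apply: (biproduct_isomorphic fg proj_biproduct (s := s)) => // i j sij.
apply: fixed_isomorphic_inj; have [u [u' uK u'K]] := sP i.
have := sP j; rewrite -sij => -[v /linear_inverse[w [vK wK]]].
by exists (w \o u); exists (u' \o v) => y /=; rewrite ?wK ?uK ?u'K ?vK.
Qed.

End Basic.

Theorem proposition6p1 (R : pzRingType) (S : centralAlgType (Cent R))
    (sigma : {rmorphism Cent R -> Cent R}) :
  semiperfect R ->
  basic S ->
  morita_equivalent_over (Cent_calg R) S ->
  bijective sigma ->
  morita_equivalent_to_op (Cent_calg R) sigma <-> has_anti_automorphism S sigma.
Proof.
move=> _ [_ [t [P [m [P_indec Pm m1]]]]] RS sigma_bij.
have [f [g fg]] := direct_sum_biproduct (multiplicities1_direct_sum Pm m1).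
rewrite (morita_equivalent_to_op_invariant sigma_bij RS); split.
  move=> [Q Q_bi Q_sigma]; apply: (regular_anti_automorphism Q_bi Q_sigma).
  exact: basic_progenerator_regular P_indec fg _ Q_bi.
exact: anti_automorphism_morita.
Qed.
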